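(* Let $\mathcal{S}\subseteq\mathcal{X}^{[\mathcal{L}]}\subset\mathbb{R}^N$ be a set of the form $$\mathcal{S}=\{y\in\mathbb{R}^N: f_i^\top y\le 1,\ i=1,\dots,q\},\qquad f_i\in\mathbb{R}^N,\ i=1,\dots,q.$$ If $\mathcal{S}$ is an admissible invariant set with respect to the lifted system $y(t+1)=A^{[\mathcal{L}]}_{\sigma(t)}y(t)$ and the constraint set $\mathcal{X}^{[\mathcal{L}]}$, then $\operatorname{lower}(\mathcal{S})$ is an admissible invariant set with respect to the system $x(t+1)=A_{\sigma(t)}x(t)$ and the constraint set $\mathcal{X}$.
   Context: System. Let $\mathcal{A}=\{A_1,\dots,A_M\}\subset\mathbb{R}^{n\times n}$. The switching system is $x(t+1)=A_{\sigma(t)}x(t)$, $t\in\mathbb{N}=\{0,1,2,\dots\}$, where $x(0)\in\mathbb{R}^n$ and $\sigma:\mathbb{N}\to\{1,\dots,M\}$ is an arbitrary switching signal. Constraint set. $\mathcal{X}=\{x\in\mathbb{R}^n: c_i(x)\le 1,\ i=1,\dots,p\}$, where $c_1,\dots,c_p$ are real polynomials of maximum degree $d\ge 1$, with no constant term (all monomials have degree in $\{1,\dots,d\}$). Standing assumptions. (1) The system is asymptotically stable (under arbitrary switching); equivalently, the joint spectral radius $\rho(\mathcal{A})=\lim_{t\to\infty}\max\{\|A\|^{1/t}: A \text{ a product of } t \text{ elements of } \mathcal{A}\}$ satisfies $\rho(\mathcal{A})<1$. (2) $\mathcal{X}$ is closed, bounded and contains the origin in its interior. Invariance. A set is invariant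 with respect to a switching system if every trajectory starting in the set remains in it for all $t\in\mathbb{N}$ and all switching signals; it is admissible invariant with respect to the system and a constraint set if moreover it is contained in that constraint set. Lifting. For an integer $l\ge 1$, the $l$-lift $x^{[l]}\in\mathbb{R}^{\binom{n+l-1}{l}}$ of $x\in\mathbb{R}^n$ is the vector with entries $\sqrt{\alpha!}\,x^\alpha$, over all $\alpha\in\mathbb{N}^n$ with $\sum_i\alpha_i=l$ (in a fixed order), where $x^\alpha=x_1^{\alpha_1}\cdots x_n^{\alpha_n}$ and $\alpha!:=\frac{l!}{\alpha_1!\cdots\alpha_n!}$ denotes the multinomial coefficient. For $A\in\mathbb{R}^{n\times n}$, $A^{[l]}$ is the matrix of the linear map satisfying $A^{[l]}x^{[l]}=(Ax)^{[l]}$ for all $x\in\mathbb{R}^n$. Let $\mathcal{L}=\{l_1,\dots,l_K\}\subseteq\{1,\dots,d\}$ (ordered) be the set of degrees of all monomials appearing in $c_1,\dots,c_p$, and $N=\sum_{l\in\mathcal{L}}\binom{n+l-1}{l}$. Then $x^{[\mathcal{L}]}\in\mathbb{R}^N$ is obtained by stacking $x^{[l_1]},\dots,x^{[l_K]}$, and $A_i^{[\mathcal{L}]}:=\operatorname{diag}(A_i^{[l_1]},\dots,A_i^{[l_K]})$ (block diagonal). The lifted system is $y(t+1)=A_{\sigma(t)}^{[\mathcal{L}]}y(t)$, $y(0)\in\mathbb{R}^N$, with arbitrary switching signal $\sigma:\mathbb{N}\to\{1,\dots,M\}$. Let $g_i\in\mathbb{R}^N$ be the vector with $c_i(x)=g_i^\top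 x^{[\mathcal{L}]}$ for all $x$, and define $\mathcal{X}^{[\mathcal{L}]}:=\{y\in\mathbb{R}^N: g_i^\top y\le 1,\ i=1,\dots,p\}$. Lowering. For $\mathcal{S}\subseteq\mathbb{R}^N$: $\operatorname{lower}(\mathcal{S}):=\{x\in\mathbb{R}^n: x^{[\mathcal{L}]}\in\mathcal{S}\}$. *)

(* Defs.v *)
From HB Require Import structures.
From mathcomp Require Import all_boot all_order all_algebra.
From mathcomp.multinomials Require Import mpoly.
From mathcomp Require Import boolp classical_sets reals topology normedtype.

Set Implicit Arguments.
Unset Strict Implicit.
Unset Printing Implicit Defensive.
Import Order.TTheory GRing.Theory Num.Theory.
Import numFieldNormedType.Exports.
Local Open Scope classical_set_scope.
Local Open Scope ring_scope.

Definition dot (R : realType) (k : nat) (u v : 'cV[R]_k) : R :=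
  (u^T *m v) ord0 ord0.

Definition trajectory (R : realType) (M k : nat) (A : 'I_M -> 'M[R]_k)
    (sigma : nat -> 'I_M) (x : nat -> 'cV[R]_k) : Prop :=
  forall t, x t.+1 = A (sigma t) *m x t.

(* Lyapunov stability, uniform in the switching signal, together with
   convergence of every trajectory to the origin; for a nonempty finite family
   this is equivalent to a joint spectral radius < 1. *)
Definition asymptotically_stable (R : realType) (M k : nat)
    (A : 'I_M -> 'M[R]_k) : Prop :=
  (forall eps : R, 0 < eps -> exists2 delta : R, 0 < delta &
     forall sigma x, trajectory A sigma x ->
       `|x 0%N| < delta -> forall t, `|x t| < eps)
  /\ (forall sigma x, trajectory A sigma x -> x t @[t --> \oo] --> (0 : 'cV[R]_k)).

Definition invariant_set (R : realType) (M k : nat) (A : 'I_M -> 'M[R]_k)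
    (S : set 'cV[R]_k) : Prop :=
  forall sigma x, trajectory A sigma x -> S (x 0%N) -> forall t, S (x t).

Definition admissible_invariant (R : realType) (M k : nat)
    (A : 'I_M -> 'M[R]_k) (S X : set 'cV[R]_k) : Prop :=
  invariant_set A S /\ S `<=` X.

Definition mp_eval (R : realType) (n : nat) (c : {mpoly R[n]})
    (x : 'cV[R]_n) : R := c.@[fun j => x j ord0].

Definition constraint_set (R : realType) (n p : nat)
    (c : 'I_p -> {mpoly R[n]}) : set 'cV[R]_n :=
  [set x | forall i, mp_eval (c i) x <= 1].

Definition polyhedron (R : realType) (k q : nat)
    (f : 'I_q -> 'cV[R]_k) : set 'cV[R]_k :=
  [set y | forall i, dot (f i) y <= 1].

(* The fixed order on the multi-indices of degree l is that of the
   multinomials library's enumeration of sorted l-tuples of variables. *)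
Definition multi_indices (n l : nat) : seq 'X_{1..n} :=
  [seq s2m t | t : l.-tuple 'I_n <- enum (mpoly.basis n l)].

Definition lift_dim (n l : nat) : nat := 'C(n + l - 1, l).

Lemma mem_multi_indices n l (a : 'X_{1..n}) :
  (a \in multi_indices n l) = (mdeg a == l).
Proof. by rewrite basis_cover. Qed.

Lemma uniq_multi_indices n l : uniq (multi_indices n l).
Proof. exact: uniq_basis. Qed.

Lemma size_multi_indices n l : size (multi_indices n l) = lift_dim n l.
Proof.
rewrite /lift_dim; case: n => [|n].
  case: l => [|l].
    have /perm_size -> : perm_eq (multi_indices 0 0) [:: 0%MM].
      apply: uniq_perm => //; first exact: uniq_multi_indices.
      move=> a; rewrite mem_multi_indices inE mdeg_eq0.
      by [].
    by [].
  rewrite add0n subn1 /= bin_small //.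
  apply/eqP; rewrite size_eq0 -[_ == _]negbK; apply/negP => H.
  have /hasP[a] : has predT (multi_indices 0 l.+1) by rewrite has_predT lt0n size_eq0.
  by rewrite mem_multi_indices mdegE big_ord0.
by rewrite size_basis addSn subn1 /= addnC.
Qed.

Definition multi_index (n l : nat) (i : 'I_(lift_dim n l)) : 'X_{1..n} :=
  nth 0%MM (multi_indices n l) i.

Definition multinomial_coef (R : realType) (n : nat) (a : 'X_{1..n}) : R :=
  (mdeg a)`!%:R / \prod_(j < n) (a j)`!%:R.

Definition lift_vec (R : realType) (n l : nat) (x : 'cV[R]_n) :
    'cV[R]_(lift_dim n l) :=
  \col_(i < lift_dim n l)
    (Num.sqrt (multinomial_coef R (multi_index i))
     * \prod_(j < n) x j ord0 ^+ multi_index i j).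

(* The default 0 is never taken: existence and uniqueness of the matrix are
   [lift_mxP] and [lift_mx_uniq]. *)
Definition lift_mx (R : realType) (n l : nat) (A : 'M[R]_n) :
    'M[R]_(lift_dim n l) :=
  xget 0 [set B | forall x : 'cV[R]_n, B *m lift_vec l x = lift_vec l (A *m x)].

Section LiftFacts.
Variables (R : realType) (n l : nat).
Implicit Types (x : 'cV[R]_n) (A : 'M[R]_n).

Let mi (i : 'I_(lift_dim n l)) : 'X_{1..n} := multi_index i.

Lemma mdeg_multi_index i : mdeg (mi i) = l.
Proof.
by apply/eqP; rewrite -mem_multi_indices mem_nth // size_multi_indices.
Qed.

Lemma multi_index_inj : injective mi.
Proof.
move=> i j /eqP; rewrite nth_uniq ?size_multi_indices ?uniq_multi_indices //.
by move/eqP/val_inj.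
Qed.

Lemma multinomial_coef_gt0 (a : 'X_{1..n}) : 0 < multinomial_coef R a.
Proof.
rewrite divr_gt0 ?ltr0n ?fact_gt0 //.
by apply: prodr_gt0 => j _; rewrite ltr0n fact_gt0.
Qed.

Let sq i : R := Num.sqrt (multinomial_coef R (mi i)).

Lemma sq_neq0 i : sq i != 0.
Proof. by rewrite gt_eqF // sqrtr_gt0 multinomial_coef_gt0. Qed.

Lemma sum_degree (P : {mpoly R[n]}) (v : 'I_n -> R) :
  \sum_(a <- msupp P | mdeg a == l) P@_a * \prod_j v j ^+ a j
  = \sum_i P@_(mi i) * \prod_j v j ^+ mi i j.
Proof.
pose F (a : 'X_{1..n}) : R := P@_a * \prod_j v j ^+ a j.
transitivity (\sum_(a <- multi_indices n l) F a).
  rewrite [RHS](bigID (mem (msupp P))) /= [X in _ + X]big1 ?addr0; last first.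
    by move=> a /memN_msupp_eq0; rewrite /F => ->; rewrite mul0r.
  rewrite -big_filter -[RHS]big_filter; apply: perm_big; apply: uniq_perm.
  - by rewrite filter_uniq // msupp_uniq.
  - by rewrite filter_uniq // uniq_multi_indices.
  by move=> a; rewrite !mem_filter mem_multi_indices andbC.
by rewrite (big_nth 0%MM) size_multi_indices big_mkord.
Qed.

Lemma meval_homog (P : {mpoly R[n]}) (v : 'I_n -> R) : P \is l.-homog ->
  P.@[v] = \sum_i P@_(mi i) * \prod_j v j ^+ mi i j.
Proof.
move=> /dhomogP hP; rewrite mevalE -sum_degree.
rewrite [LHS]big_seq_cond [RHS]big_seq_cond; apply: eq_bigl => a.
by rewrite andbT; case aP: (a \in msupp P) => //=; rewrite (hP _ aP) eqxx.
Qed.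

Lemma lift_mx_exists A :
  exists B : 'M[R]_(lift_dim n l), forall x, B *m lift_vec l x = lift_vec l (A *m x).
Proof.
pose Q (a : 'X_{1..n}) : {mpoly R[n]} :=
  \prod_(k < n) (\sum_(j < n) A k j *: 'X_j) ^+ a k.
have homQ a : Q a \is (mdeg a).-homog.
  rewrite mdegE /Q; elim/big_rec2: _ => [|k d P _ hP]; first exact: dhomog1.
  apply: dhomogM hP; rewrite -[X in X.-homog]mul1n; apply: dhomogMn.
  by apply: rpred_sum => j _; apply: rpredZ; rewrite dhomogX /= mdeg1.
exists (\matrix_(i, j) (sq i * (Q (mi i))@_(mi j) / sq j)) => x.
apply/colP => i; rewrite !mxE.
have -> : \prod_(k < n) (A *m x) k ord0 ^+ mi i k = (Q (mi i)).@[fun j => x j ord0].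
  rewrite rmorph_prod; apply: eq_bigr => k _.
  rewrite rmorphXn /= raddf_sum mxE; congr (_ ^+ _); apply: eq_bigr => j _.
  by rewrite /= mevalZ mevalXU.
rewrite meval_homog; last by rewrite -[X in X.-homog](mdeg_multi_index i).
rewrite mulr_sumr; apply: eq_bigr => j _; rewrite !mxE -/(sq j) -/(sq i) -/(mi j).
by rewrite -!mulrA; congr (_ * (_ * _)); rewrite mulKf // sq_neq0.
Qed.

Lemma lift_mxP A x : lift_mx l A *m lift_vec l x = lift_vec l (A *m x).
Proof.
rewrite /lift_mx; case: xgetP => [B _ /(_ x) //|].
by have [B hB] := lift_mx_exists A => /(_ B); case.
Qed.

Lemma lift_dot_eq0 (v : 'rV[R]_(lift_dim n l)) :
  (forall x, v *m lift_vec l x = 0) -> v = 0.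
Proof.
move=> hv.
pose e (a : 'X_{1..n}) := (\sum_(j < n) a j * l.+1 ^ j)%N.
have e_inj : {in [pred a : 'X_{1..n} | mdeg a == l] &, injective e}.
  move=> a b; rewrite !inE => /eqP ha /eqP hb.
  have ub (c : 'X_{1..n}) (i : 'I_n) : mdeg c = l -> (c i < l.+1)%N.
    by move=> <-; rewrite ltnS mdegE (bigD1 i) //= leq_addr.
  have aux m (F G : 'I_m -> nat) : (forall i, F i < l.+1)%N ->
      (forall i, G i < l.+1)%N ->
      (\sum_(j < m) F j * l.+1 ^ j = \sum_(j < m) G j * l.+1 ^ j)%N -> F =1 G.
    elim: m F G => [|m IH] F G hF hG; first by move=> _ [].
    have split_sum (H : 'I_m.+1 -> nat) :
        (\sum_(j < m.+1) H j * l.+1 ^ j =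
         (\sum_(j < m) H (fintype.lift ord0 j) * l.+1 ^ j) * l.+1 + H ord0)%N.
      rewrite big_ord_recl expn0 muln1 addnC; congr (_ + _)%N.
      by rewrite big_distrl; apply: eq_bigr => j _; rewrite lift0 expnSr mulnA.
    rewrite !split_sum => E.
    have E0 : F ord0 = G ord0.
      by have := congr1 (modn^~ l.+1) E; rewrite !modnMDl !modn_small.
    move: E; rewrite E0 => /addIn /eqP; rewrite eqn_pmul2r // => /eqP /IH E i.
    case: (unliftP ord0 i) => [j ->|-> //].
    exact: (E (fun i => hF _) (fun i => hG _) j).
  by move=> /aux E; apply/mnmP => i; apply: E => j; apply: ub.
pose P : {poly R} := \sum_i (v ord0 i * sq i) *: 'X^(e (mi i)).
have P0 : P = 0.
  have [//|Pn0] := eqVneq P 0.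
  suff: (size [seq k%:R : R | k <- iota 0 (size P)] < size P)%N.
    by rewrite size_map size_iota ltnn.
  apply: max_poly_roots => //; last first.
    by rewrite map_inj_uniq ?iota_uniq // => i j /eqP; rewrite eqr_nat => /eqP.
  apply/allP => _ /mapP[k _ ->]; rewrite /root /P horner_sum.
  have /rowP/(_ ord0) := hv (\col_(j < n) (k%:R ^+ (l.+1 ^ j))).
  rewrite !mxE => h0; apply/eqP; rewrite -[RHS]h0; apply: eq_bigr => i _.
  rewrite hornerZ hornerXn !mxE -/(sq i) -mulrA; congr (_ * (_ * _)).
  rewrite /e -prodrXr; apply: eq_bigr => j _.
  by rewrite mxE -exprM mulnC.
apply/rowP => i; rewrite mxE.
have := congr1 (fun q : {poly R} => q`_(e (mi i))) P0.
rewrite /P coef_sum (bigD1 i) //= coef0 coefZ coefXn eqxx mulr1 big1 ?addr0.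
  by move=> /eqP; rewrite mulf_eq0 (negbTE (sq_neq0 i)) orbF => /eqP.
move=> j /negbTE ji; rewrite coefZ coefXn; case: eqP => [E|]; last by rewrite mulr0.
move: ji; suff -> : j = i by rewrite eqxx.
by apply: multi_index_inj; apply: e_inj; rewrite ?inE ?mdeg_multi_index.
Qed.

Lemma lift_mx_uniq A (B : 'M[R]_(lift_dim n l)) :
  (forall x, B *m lift_vec l x = lift_vec l (A *m x)) -> B = lift_mx l A.
Proof.
move=> hB; apply/eqP; rewrite -subr_eq0; apply/eqP/row_matrixP => i.
rewrite row0; apply: lift_dot_eq0 => x.
by rewrite -row_mul mulmxBl hB lift_mxP subrr row0.
Qed.

End LiftFacts.

Definition degree_set (R : realType) (n p : nat)
    (c : 'I_p -> {mpoly R[n]}) : seq nat :=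
  sort leq (undup [seq mdeg m | i <- enum 'I_p, m <- msupp (c i)]).

Definition liftL_dim (n : nat) (L : seq nat) : nat :=
  \sum_(k < size L) lift_dim n (nth 0%N L k).

Definition liftL (R : realType) (n : nat) (L : seq nat) (x : 'cV[R]_n) :
    'cV[R]_(liftL_dim n L) :=
  \mxcol_(k < size L) lift_vec (nth 0%N L k) x.

Definition liftL_mx (R : realType) (n : nat) (L : seq nat) (A : 'M[R]_n) :
    'M[R]_(liftL_dim n L) :=
  \mxdiag_(k < size L) lift_mx (nth 0%N L k) A.

Lemma liftL_coef_exists (R : realType) (n p : nat)
    (c : 'I_p -> {mpoly R[n]}) (i : 'I_p) :
  exists g : 'cV[R]_(liftL_dim n (degree_set c)),
    forall x, mp_eval (c i) x = dot g (liftL (degree_set c) x).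
Proof.
set L := degree_set c.
have uL : uniq L by rewrite sort_uniq undup_uniq.
have LP a : a \in msupp (c i) -> mdeg a \in L.
  move=> ha; rewrite mem_sort mem_undup; apply/allpairsPdep.
  by exists i, a; rewrite mem_enum.
exists (\mxcol_(k < size L) \col_(j < lift_dim n (nth 0%N L k))
  ((c i)@_(multi_index j) / Num.sqrt (multinomial_coef R (multi_index j)))) => x.
rewrite /dot /liftL tr_mxcol mul_mxrow_mxcol summxE /mp_eval mevalE.
transitivity (\sum_(l <- L) \sum_(a <- msupp (c i) | mdeg a == l)
    (c i)@_a * \prod_j x j ord0 ^+ a j).
  rewrite (exchange_big_dep predT) //= [LHS]big_seq [RHS]big_seq.
  apply: eq_bigr => a /LP ha; rewrite -[RHS]big_filter.
  rewrite (eq_filter (a2 := pred1 (mdeg a))); last by move=> l; rewrite /= eq_sym.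
  by rewrite filter_pred1_uniq // big_seq1.
rewrite (big_nth 0%N) big_mkord; apply: eq_bigr => k _.
rewrite sum_degree mxE; apply: eq_bigr => j _; rewrite !mxE.
by rewrite -mulrA mulKf // sq_neq0.
Qed.

Definition lower (R : realType) (n : nat) (L : seq nat)
    (S : set 'cV[R]_(liftL_dim n L)) : set 'cV[R]_n :=
  [set x | S (liftL L x)].

(* Main.v *)
Require Import Defs.
From HB Require Import structures.
From mathcomp Require Import all_boot all_order all_algebra.
From mathcomp.multinomials Require Import mpoly.
From mathcomp Require Import boolp classical_sets reals topology normedtype.
Import Order.TTheory GRing.Theory Num.Theory.
Import numFieldNormedType.Exports.
Local Open Scope classical_set_scope.
Local Open Scope ring_scope.

(** Lifting conjugates the dynamics: [liftL L (A x) = liftL_mx L A (liftL L x)],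
so a trajectory of the system lifts, under the same switching signal, to a
trajectory of the lifted system.  If it starts in [lower S], the lifted one
starts in [S], and invariance of [S] keeps it there, which is the invariance
of [lower S].  Admissibility holds because [g i] represents the polynomial
[c i] on lifted vectors, so the polyhedron cut out by the [g i] lowers to
[constraint_set c]. *)

(** The diagonal blocks act separately on the stacked lifts, so this reduces to
the defining property of each block, [lift_mxP]. *)
Lemma liftL_mxP (R : realType) (n : nat) (L : seq nat) (A : 'M[R]_n)
    (x : 'cV[R]_n) :
  liftL_mx L A *m liftL L x = liftL L (A *m x).
Proof.
rewrite /liftL_mx /liftL mul_mxdiag_mxcol.
by apply: eq_mxcol => k; rewrite lift_mxP.
Qed.

Lemma trajectory_liftL (R : realType) (M n : nat) (L : seq nat)
    (A : 'I_M -> 'M[R]_n) (sigma : nat -> 'I_M) (x : nat -> 'cV[R]_n) :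
  trajectory A sigma x ->
  trajectory (fun i => liftL_mx L (A i)) sigma (fun t => liftL L (x t)).
Proof. by move=> xA t; rewrite liftL_mxP -xA. Qed.

Lemma invariant_set_lower (R : realType) (M n : nat) (L : seq nat)
    (A : 'I_M -> 'M[R]_n) (S : set 'cV[R]_(liftL_dim n L)) :
  invariant_set (fun i => liftL_mx L (A i)) S -> invariant_set A (lower S).
Proof. by move=> invS sigma x /(@trajectory_liftL _ _ _ L) /invS. Qed.

Theorem proposition2 (R : realType) (n M p q d : nat)
    (A : 'I_M -> 'M[R]_n)
    (c : 'I_p -> {mpoly R[n]})
    (d_ge1 : (1 <= d)%N)
    (c_deg : forall i m, m \in msupp (c i) -> (1 <= mdeg m <= d)%N)
    (A_stable : asymptotically_stable A)
    (X_closed : closed (constraint_set c))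
    (X_bounded : bounded_set (constraint_set c))
    (X_origin : interior (constraint_set c) 0)
    (g : 'I_p -> 'cV[R]_(liftL_dim n (degree_set c)))
    (g_spec : forall i (x : 'cV[R]_n),
      mp_eval (c i) x = dot (g i) (liftL (degree_set c) x))
    (f : 'I_q -> 'cV[R]_(liftL_dim n (degree_set c)))
    (S : set 'cV[R]_(liftL_dim n (degree_set c)))
    (S_def : S = polyhedron f)
    (S_sub : S `<=` polyhedron g)
    (S_inv : admissible_invariant
      (fun i => liftL_mx (degree_set c) (A i)) S (polyhedron g)) :
  admissible_invariant A (lower S) (constraint_set c).
Proof.
case: S_inv => invS _; split; first exact: invariant_set_lower.
by move=> x /S_sub gx i; rewrite g_spec; apply: gx.
Qed.
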